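(* Let $p_\sigma\in[0,1]$ be given for every $\sigma\in\partial\Delta_n$, and set $q_\sigma=1-p_\sigma$. Let $\mathbb P_n$ be the corresponding probability measure on hypergraphs $X\subseteq\partial\Delta_n$, with associated upper and lower measures $\overline{\mathbb P}_n$ and $\underline{\mathbb P}_n$. Define a new probability measure $\mathbb P'_n$ on hypergraphs by the parameters $p'_\sigma=q_{\hat\sigma}=1-p_{\hat\sigma}$, $\sigma\in\partial\Delta_n$, with associated upper and lower measures $\overline{\mathbb P}'_n$ and $\underline{\mathbb P}'_n$. Then: (1) For every hypergraph $X\subseteq\partial\Delta_n$, $\mathbb P_n(c(X))=\mathbb P'_n(X)$. (2) For every simplicial complex $Y\subseteq\partial\Delta_n$, $\overline{\mathbb P}_n(c(Y))=\underline{\mathbb P}'_n(Y)$ and $\underline{\mathbb P}_n(c(Y))=\overline{\mathbb P}'_n(Y)$.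
   Context: $[n]=\{0,1,\dots,n\}$; $\partial\Delta_n$ is the set of all non-empty proper subsets (simplexes) of $[n]$. A hypergraph $X\subseteq\partial\Delta_n$ is any subset of $\partial\Delta_n$; it is a simplicial complex if it is closed under taking non-empty subsets of its members (the empty complex is allowed). For parameters $p_\sigma$, the measure $\mathbb P_n$ is given by $\mathbb P_n(X)=\prod_{\sigma\in X}p_\sigma\cdot\prod_{\sigma\in\partial\Delta_n,\ \sigma\notin X}q_\sigma$ for $X\subseteq\partial\Delta_n$. For a hypergraph $X$, $\overline X$ is the smallest simplicial complex containing $X$ and $\underline X$ is the largest simplicial complex contained in $X$. The upper and lower measures on simplicial complexes $Y\subseteq\partial\Delta_n$ are $\overline{\mathbb P}_n(Y)=\sum_{X:\overline X=Y}\mathbb P_n(X)$ and $\underline{\mathbb P}_n(Y)=\sum_{X:\underline X=Y}\mathbb P_n(X)$. For $\sigma\in\partial\Delta_n$, $\hat\sigma=[n]\setminus\sigma$. The dual of a hypergraph $X\subseteq\partial\Delta_n$ is $c(X)=\{\hat\sigma:\sigma\in\partial\Delta_n,\ \sigma\notin X\}$; if $X$ is a simplicial complex, so is $c(X)$. *)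

(* Defs.v *)
From mathcomp Require Import all_boot all_order all_algebra.

Set Implicit Arguments.
Unset Strict Implicit.
Unset Printing Implicit Defensive.

Import Order.TTheory GRing.Theory Num.Theory.
Local Open Scope ring_scope.

(* The vertex set [n] = {0, 1, ..., n} has n + 1 elements: it is 'I_n.+1. *)
Definition bdDelta (n : nat) : {set {set 'I_n.+1}} :=
  [set s : {set 'I_n.+1} | (s != set0) && (s != setT)].

Definition hypergraph (n : nat) (X : {set {set 'I_n.+1}}) : bool :=
  X \subset bdDelta n.

(* The empty complex is allowed. *)
Definition simplicial_complex (n : nat) (X : {set {set 'I_n.+1}}) : bool :=
  hypergraph X &&
  [forall s in X, forall t : {set 'I_n.+1},
     (t != set0) && (t \subset s) ==> (t \in X)].

(* Smallest complex containing X and largest complex contained in X; see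
   upper_complexP and lower_complexP. *)
Definition upper_complex (n : nat) (X : {set {set 'I_n.+1}}) :
    {set {set 'I_n.+1}} :=
  \bigcap_(K : {set {set 'I_n.+1}} | simplicial_complex K && (X \subset K)) K.

Definition lower_complex (n : nat) (X : {set {set 'I_n.+1}}) :
    {set {set 'I_n.+1}} :=
  \bigcup_(K : {set {set 'I_n.+1}} | simplicial_complex K && (K \subset X)) K.

Definition dual (n : nat) (X : {set {set 'I_n.+1}}) : {set {set 'I_n.+1}} :=
  [set ~: s | s in bdDelta n :\: X].

(* The values of p outside of bdDelta n are irrelevant in all that follows. *)
Definition measure (R : realFieldType) (n : nat) (p : {set 'I_n.+1} -> R)
    (X : {set {set 'I_n.+1}}) : R :=
  (\prod_(s in X) p s) * (\prod_(s in bdDelta n :\: X) (1 - p s)).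

Definition upper_measure (R : realFieldType) (n : nat)
    (p : {set 'I_n.+1} -> R) (Y : {set {set 'I_n.+1}}) : R :=
  \sum_(X : {set {set 'I_n.+1}} | hypergraph X && (upper_complex X == Y))
     measure p X.

Definition lower_measure (R : realFieldType) (n : nat)
    (p : {set 'I_n.+1} -> R) (Y : {set {set 'I_n.+1}}) : R :=
  \sum_(X : {set {set 'I_n.+1}} | hypergraph X && (lower_complex X == Y))
     measure p X.

Definition dual_param (R : realFieldType) (n : nat)
    (p : {set 'I_n.+1} -> R) : {set 'I_n.+1} -> R :=
  fun s => 1 - p (~: s).

Lemma simplicial_complexP (n : nat) (X : {set {set 'I_n.+1}}) :
  reflect (hypergraph X /\
           forall s t : {set 'I_n.+1},
             s \in X -> t != set0 -> t \subset s -> t \in X)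
          (simplicial_complex X).
Proof.
apply: (iffP andP) => -[hX cX]; split=> //.
  by move=> s t sX t0 ts; have /forall_inP/(_ s sX)/forallP/(_ t) := cX;
    rewrite t0 ts.
apply/forall_inP=> s sX; apply/forallP=> t; apply/implyP=> /andP[t0 ts].
exact: cX sX t0 ts.
Qed.

Lemma simplicial_complex_bdDelta (n : nat) : simplicial_complex (bdDelta n).
Proof.
apply/simplicial_complexP; split=> [|s t]; first exact: subxx.
rewrite !inE => /andP[_ sT] -> ts /=.
by apply: contra sT => /eqP tT; rewrite -subTset -tT.
Qed.

Lemma upper_complexP (n : nat) (X : {set {set 'I_n.+1}}) : hypergraph X ->
  [/\ simplicial_complex (upper_complex X), X \subset upper_complex X
    & forall K, simplicial_complex K -> X \subset K ->
        upper_complex X \subset K].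
Proof.
move=> hX; have minX K : simplicial_complex K -> X \subset K ->
  upper_complex X \subset K.
  by move=> cK XK; apply: (bigcap_inf K); rewrite ?cK.
split=> //; last by apply/bigcapsP=> K /andP[].
apply/simplicial_complexP; split.
  exact: minX (simplicial_complex_bdDelta n) hX.
move=> s t /bigcapP sX t0 ts; apply/bigcapP=> K cK.
have /andP[/simplicial_complexP[_ clK] _] := cK.
exact: clK (sX K cK) t0 ts.
Qed.

Lemma lower_complexP (n : nat) (X : {set {set 'I_n.+1}}) :
  [/\ simplicial_complex (lower_complex X), lower_complex X \subset X
    & forall K, simplicial_complex K -> K \subset X ->
        K \subset lower_complex X].
Proof.
split; last by move=> K cK KX; apply: (bigcup_sup K); rewrite ?cK.
  apply/simplicial_complexP; split.
    by apply/bigcupsP=> K /andP[/simplicial_complexP[]].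
  move=> s t /bigcupP[K cK sK] t0 ts; apply/bigcupP; exists K => //.
  have /andP[/simplicial_complexP[_ clK] _] := cK.
  exact: clK sK t0 ts.
by apply/bigcupsP=> K /andP[].
Qed.

Lemma measure_ge0 (R : realFieldType) (n : nat) (p : {set 'I_n.+1} -> R) :
  (forall s, s \in bdDelta n -> 0 <= p s <= 1) ->
  forall X, hypergraph X -> 0 <= measure p X.
Proof.
move=> p01 X /subsetP hX; apply: mulr_ge0; apply: prodr_ge0 => s.
  by move=> /hX/p01/andP[].
by rewrite inE => /andP[_ /p01/andP[_]]; rewrite subr_ge0.
Qed.

Lemma measure_sum1 (R : realFieldType) (n : nat) (p : {set 'I_n.+1} -> R) :
  \sum_(X : {set {set 'I_n.+1}} | hypergraph X) measure p X = 1.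
Proof.
pose F s := if s \in bdDelta n then p s else 0.
pose G s := if s \in bdDelta n then 1 - p s else 1.
transitivity (\prod_(s : {set 'I_n.+1}) (F s + G s)); last first.
  by apply: big1 => s _; rewrite /F /G; case: ifP; rewrite ?add0r // subrKC.
rewrite bigA_distr big_mkcond /=; apply: eq_bigr => X _; case: ifPn => hX.
  rewrite (bigID (mem X)) /=; congr (_ * _).
    by apply: eq_bigr => s sX; rewrite sX /F (subsetP hX).
  rewrite [RHS](bigID (mem (bdDelta n))) /= [X in _ = _ * X]big1 ?mulr1.
    by apply: eq_big => [s|s]; rewrite !inE // => /andP[/negPf-> sb];
      rewrite /G inE sb.
  by move=> s /andP[/negPf-> /negPf sb]; rewrite /G sb.
have /subsetPn[s sX /negPf sb] := hX.
by rewrite (bigD1 s) //= sX /F sb mul0r.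
Qed.

(* Main.v *)
Require Import Defs.
From mathcomp Require Import all_boot all_order all_algebra.

Set Implicit Arguments.
Unset Strict Implicit.
Unset Printing Implicit Defensive.

Import Order.TTheory GRing.Theory Num.Theory.
Local Open Scope ring_scope.

(** The dual negates the indicator function of a hypergraph and transports it
    along the involution taking a simplex to its complement.  A simplex
    belongs to the dual of X exactly when its complement does not belong to X,
    so the factor p s that it contributes to the measure of the dual is the
    factor 1 - p' of its complement under the dual parameters, and vice versa:
    this is the first assertion ([measure_dual]).

    On hypergraphs, duality is an involution that reverses inclusion and
    preserves simplicial complexes.  It therefore exchanges the smallest
    complex above a hypergraph with the largest complex below its dual
    ([upper_complex_dual], [lower_complex_dual]).  The second assertion results
    from reindexing the sums that define the upper and lower measures along
    this involution ([big_dual]). *)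

Lemma setC_bdDelta (n : nat) (s : {set 'I_n.+1}) :
  (~: s \in bdDelta n) = (s \in bdDelta n).
Proof.
have eC (t : {set 'I_n.+1}) : (~: s == t) = (s == ~: t).
  by rewrite -(inj_eq (@setC_inj _)) setCK.
by rewrite !inE !eC setC0 setCT andbC.
Qed.

Lemma in_dual (n : nat) (X : {set {set 'I_n.+1}}) (s : {set 'I_n.+1}) :
  (s \in dual X) = (s \in bdDelta n) && (~: s \notin X).
Proof.
by rewrite -{1}[s]setCK (mem_imset _ _ (@setC_inj _)) inE setC_bdDelta andbC.
Qed.

Lemma dual_hypergraph (n : nat) (X : {set {set 'I_n.+1}}) :
  hypergraph (dual X).
Proof. by apply/subsetP=> s; rewrite in_dual => /andP[]. Qed.

Lemma dual_dual (n : nat) (X : {set {set 'I_n.+1}}) :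
  dual (dual X) = X :&: bdDelta n.
Proof.
apply/setP=> s; rewrite in_dual in_dual setC_bdDelta setCK in_setI.
by case: (s \in bdDelta n); rewrite ?andbF ?negbK ?andbT.
Qed.

Lemma dualK (n : nat) (X : {set {set 'I_n.+1}}) :
  hypergraph X -> dual (dual X) = X.
Proof. by move=> /setIidPl hX; rewrite dual_dual. Qed.

Lemma dual_inj (n : nat) : {in @hypergraph n &, injective (@dual n)}.
Proof. by apply: (can_in_inj (g := @dual n)) => X; apply: dualK. Qed.

Lemma dualS (n : nat) (X Y : {set {set 'I_n.+1}}) :
  X \subset Y -> dual Y \subset dual X.
Proof.
move=> /subsetP XY; apply/subsetP=> s; rewrite !in_dual => /andP[-> /=].
exact/contra/XY.
Qed.

Lemma simplicial_complex_hypergraph (n : nat) (X : {set {set 'I_n.+1}}) :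
  simplicial_complex X -> hypergraph X.
Proof. by case/andP. Qed.

(** Taking complements of simplexes turns a family closed downwards into one
    closed upwards, and taking the complement of the family turns it back. *)
Lemma simplicial_complex_dual (n : nat) (X : {set {set 'I_n.+1}}) :
  simplicial_complex X -> simplicial_complex (dual X).
Proof.
move=> /simplicial_complexP[_ clX]; apply/simplicial_complexP.
split=> [|s t]; first exact: dual_hypergraph.
rewrite !in_dual => /andP[sb sX] t0 ts.
have /simplicial_complexP[_ clb] := simplicial_complex_bdDelta n.
rewrite (clb s t) //=; apply: contra sX => tX.
apply: clX tX _ _; last by rewrite setCS.
by move: sb; rewrite -setC_bdDelta inE => /andP[].
Qed.

(** The dual of a complex below X is a complex above the dual of X, and
    conversely; hence the extremal ones correspond. *)
Lemma upper_complex_dual (n : nat) (X : {set {set 'I_n.+1}}) :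
  hypergraph X -> upper_complex (dual X) = dual (lower_complex X).
Proof.
move=> hX; have [cU dXU minU] := upper_complexP (dual_hypergraph X).
have [cL LX maxL] := lower_complexP X.
apply/eqP; rewrite eqEsubset minU ?simplicial_complex_dual ?dualS //=.
rewrite -[upper_complex _]dualK ?simplicial_complex_hypergraph // dualS //.
by rewrite maxL ?simplicial_complex_dual // -{2}(dualK hX) dualS.
Qed.

Lemma lower_complex_dual (n : nat) (X : {set {set 'I_n.+1}}) :
  hypergraph X -> lower_complex (dual X) = dual (upper_complex X).
Proof.
move=> hX; have [/simplicial_complex_hypergraph hL _ _] :=
  lower_complexP (dual X).
by rewrite -[LHS]dualK // -upper_complex_dual ?dualK // dual_hypergraph.
Qed.

Lemma measure_dual (R : realFieldType) (n : nat) (p : {set 'I_n.+1} -> R)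
    (X : {set {set 'I_n.+1}}) :
  hypergraph X -> measure p (dual X) = measure (dual_param p) X.
Proof.
move=> /subsetP hX; rewrite /measure mulrC; congr (_ * _).
  rewrite (reindex_inj (@setC_inj _)); apply: eq_bigl => s.
  rewrite in_setD in_dual setC_bdDelta setCK.
  by have [/hX-> | sX] := boolP (s \in X); rewrite ?andbT ?andNb.
rewrite big_imset /=; last by move=> s t _ _; apply: setC_inj.
by apply: eq_bigr => s _; rewrite /dual_param subKr.
Qed.

Lemma big_dual (V : nmodType) (n : nat) (P : pred {set {set 'I_n.+1}})
    (F : {set {set 'I_n.+1}} -> V) :
  \sum_(X | hypergraph X && P X) F X =
  \sum_(X | hypergraph X && P (dual X)) F (dual X).
Proof.
rewrite (reindex_onto (@dual n) (@dual n)) /=; last first.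
  by move=> X /andP[/dualK].
apply: eq_bigl => X; rewrite dual_hypergraph /= andbC; congr (_ && _).
(* The fixed points of double dualization are exactly the hypergraphs. *)
by rewrite dual_dual; apply/eqP/idP => [<-|/setIidPl//]; apply: subsetIr.
Qed.

Theorem proposition4p3 (R : realFieldType) (n : nat) (p : {set 'I_n.+1} -> R)
    (p01 : forall s : {set 'I_n.+1}, s \in bdDelta n -> 0 <= p s <= 1) :
  (forall X : {set {set 'I_n.+1}}, hypergraph X ->
     measure p (dual X) = measure (dual_param p) X) /\
  (forall Y : {set {set 'I_n.+1}}, simplicial_complex Y ->
     upper_measure p (dual Y) = lower_measure (dual_param p) Y /\
     lower_measure p (dual Y) = upper_measure (dual_param p) Y).
Proof.
split=> [X|Y cY]; first exact: measure_dual.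
have hY := simplicial_complex_hypergraph cY.
split; rewrite /upper_measure /lower_measure big_dual.
  apply: eq_big => [X|X /andP[hX _]]; last exact: measure_dual.
  apply: andb_id2l => hX; rewrite upper_complex_dual //.
  rewrite (inj_in_eq (@dual_inj n)) //.
  by have [/simplicial_complex_hypergraph] := lower_complexP X.
apply: eq_big => [X|X /andP[hX _]]; last exact: measure_dual.
apply: andb_id2l => hX; rewrite lower_complex_dual //.
rewrite (inj_in_eq (@dual_inj n)) //.
by have [/simplicial_complex_hypergraph] := upper_complexP hX.
Qed.
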